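(* Let $G = G_1 \times G_2$ be a group of order $2^{2n}$ with $|G_1| = 2^{v_1}$ and $|G_2| = 2^{v_2}$, where $v_1$ and $v_2$ are even. Let $D_1$ be a difference set in $G_1$ and $D_2$ a difference set in $G_2$. Then the difference set \[D = \big(D_1 \times (G_2 - D_2)\big) \cup \big((G_1 - D_1) \times D_2\big)\] in $G$ has the symmetric difference property if and only if $D_1$ and $D_2$ both have the symmetric difference property.
   Context: A $(v,k,\lambda)$ difference set in a group $G$ of order $v$ is a subset $D \subseteq G$ with $|D| = k$ such that the multiset $\{d_1 d_2^{-1} : d_1, d_2 \in D\}$ contains every non-identity element of $G$ exactly $\lambda$ times. The development of $D$ is the symmetric design whose points are the elements of $G$, whose blocks are the left translates $gD$ ($g \in G$), with incidence given by membership. A symmetric design has the symmetric difference property (SDP) if the symmetric difference $A \,\Delta\, B \,\Delta\, C$ of any three blocks (where $A \Delta B = (A-B)\cup(B-A)$) is either a block or the complement of a block; equivalently, the mod-2 sum of any three rows of its incidence matrix is a row or the complement of a row. A difference set is said to have the SDP if its development has the SDP.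
   Formalization: That D is itself a difference set is asserted only when D_1 and D_2 are nontrivial (1<k<v-1, or order 4 with 0<k<4, or order 1), as it fails e.g. for D_1 empty and |D_2|=1 in groups of order 4; the SDP equivalence is stated for all D_1, D_2. *)

(* Defs.v *)
From mathcomp Require Import all_boot all_fingroup.

Set Implicit Arguments.
Unset Strict Implicit.
Unset Printing Implicit Defensive.

Import GroupScope.

Definition difference_set (gT : finGroupType) (v k lambda : nat)
    (D : {set gT}) : Prop :=
  [/\ #|gT| = v, #|D| = k &
      forall g : gT, g != 1 ->
        #|[set p in setX D D | p.1 * p.2^-1 == g]| = lambda].

(* Blocks of the development; the points are all the elements of gT. Blocks
   are recorded without multiplicity, which the property below does not see. *)
Definition development (gT : finGroupType) (D : {set gT}) : {set {set gT}} :=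
  [set g *: D | g : gT].

Definition symdiff (T : finType) (A B : {set T}) : {set T} :=
  (A :\: B) :|: (B :\: A).

(* The three blocks need not be distinct: if two of them coincide, the
   symmetric difference is the third one and the condition holds anyway. *)
Definition SDP (T : finType) (blocks : {set {set T}}) : Prop :=
  forall A B C : {set T}, A \in blocks -> B \in blocks -> C \in blocks ->
    symdiff (symdiff A B) C \in blocks \/
    ~: symdiff (symdiff A B) C \in blocks.

Definition has_SDP (gT : finGroupType) (D : {set gT}) : Prop :=
  SDP (development D).

Definition diffset_product (gT1 gT2 : finGroupType)
    (D1 : {set gT1}) (D2 : {set gT2}) : {set gT1 * gT2} :=
  setX D1 (~: D2) :|: setX (~: D1) D2.

(* The usual condition 1 < k < v - 1, except that the smallest members of the
   family (2^(2m), 2^(2m-1) +- 2^(m-1), 2^(2m-2) +- 2^(m-1)) are kept: for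
   m = 1 the parameters (4,1,0) and (4,3,2), for m = 0 the group of order 1. *)
Definition nontrivial (gT : finGroupType) (D : {set gT}) : bool :=
  [|| 1 < #|D| < #|gT|.-1, (#|gT| == 4) && (0 < #|D| < 4) | #|gT| == 1%N].

(* Main.v *)
Require Import Defs.
From mathcomp Require Import all_boot all_fingroup.
From mathcomp Require Import all_algebra all_solvable.
From mathcomp Require Import zify ring.

(* SDP: writing sets as characteristic functions mod 2, the translate of D by
   (g1, g2) is the function g1 D1(x) + g2 D2(y), and adding three of them
   treats the two coordinates independently.

   Difference set: in terms of the (+1, -1)-valued functions of the sets, D is
   the tensor product of D1 and D2, so its autocorrelation is the product of
   theirs.  It vanishes off the identity as soon as v = 4 (k - lambda) for both
   factors.  For a nontrivial difference set in a 2-group this holds: a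
   character of order 2 shows that k - lambda = t^2 is a square, and then
   k^2 = (k - lambda) + lambda v becomes u^2 + (v - 1) t^2 = (v / 2)^2 with
   u = |v / 2 - k|, whose solutions with v a power of 2 are found by dividing
   out the common power of 2 of t and u and comparing u with t modulo v / 2. *)

(** * The Diophantine equation u^2 + (2^(r+1) - 1) t^2 = 2^(2c) *)

Section Arithmetic.

Local Set Implicit Arguments.
Local Unset Strict Implicit.

(** Exactly one of [x] and [y] is odd, hence coprime to 2^e, so the whole power divides the
    other. *)
Lemma pow2_dvd_mul_odd_sum (e x y : nat) :
  odd (x + y) -> 2 ^ e %| x * y -> (2 ^ e %| x) || (2 ^ e %| y).
Proof.
rewrite oddD; case ox: (odd x) => /= oy.
  by rewrite Gauss_dvdr ?coprimeXl ?coprime2n // => ->; rewrite orbT.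
have {}oy : odd y by case: (odd y) oy.
by rewrite Gauss_dvdl ?coprimeXl ?coprime2n // => ->.
Qed.

(** With u = 2a + 1 and t = 2b + 1 the difference of squares is 4 (a - b) (a + b + 1), whose last
    two factors have odd sum 2a + 1. *)
Lemma pow2_dvd_sub_sqr_odd (r u t : nat) : odd u -> odd t -> t <= u ->
  2 ^ r.+1 %| u ^ 2 - t ^ 2 -> (2 ^ r %| u - t) || (2 ^ r %| u + t).
Proof.
move=> ou ot tu; case: r => [|r]; first by rewrite dvd1n.
have [a ua] : exists a, u = 2 * a + 1 by exists (u./2); lia.
have [b tb] : exists b, t = 2 * b + 1 by exists (t./2); lia.
have subE : u - t = 2 * (a - b) by lia.
have addE : u + t = 2 * (a + b + 1) by lia.
rewrite subn_sqr subE addE mulnACA -(addn2 r) addnC expnD dvdn_pmul2l //.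
rewrite !expnS !dvdn_pmul2l //.
by apply: pow2_dvd_mul_odd_sum; lia.
Qed.

(** Modulo 2^(r+1) the equation says u^2 = t^2, so 2^r divides u - t or u + t. As t <= u < 2^c <=
    2^r, this leaves u = t, which gives the first alternative, or u + t = 2^r, which gives the
    second. *)
Lemma sum_sqr_pow2_odd (r c u t : nat) : odd u -> odd t -> c <= r ->
  u ^ 2 + (2 ^ r.+1 - 1) * t ^ 2 = 2 ^ (2 * c) ->
  2 ^ r.+1 * t ^ 2 = 2 ^ (2 * c) \/ t = 1 /\ c = r.
Proof.
move=> ou ot cr E.
have u0 : 0 < u by apply: odd_gt0.
have t0 : 0 < t by apply: odd_gt0.
have cle : 2 ^ c <= 2 ^ r by rewrite leq_exp2l.
have Pr : 0 < 2 ^ r by rewrite expn_gt0.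
(* Since u and t are positive, the right side exceeds 2^(r+1) - 1; being a power of 2, it is then a
   multiple of 2^(r+1). *)
have VW : 2 ^ r.+1 <= 2 ^ (2 * c).
  rewrite -E; have : 0 < u ^ 2 by rewrite expn_gt0 u0.
  have : 2 ^ r.+1 - 1 <= (2 ^ r.+1 - 1) * t ^ 2 by rewrite leq_pmulr // expn_gt0 t0.
  by lia.
have dVW : 2 ^ r.+1 %| 2 ^ (2 * c).
  by apply: dvdn_exp2l; rewrite leq_exp2l in VW.
have back : 2 ^ c = 2 ^ r -> c = r by move/eqP; rewrite eqn_exp2l // => /eqP.
have Wc : 2 ^ (2 * c) = (2 ^ c) ^ 2 by rewrite mulnC expnM.
have Vr : 2 ^ r.+1 = 2 * 2 ^ r by rewrite expnS.
have near := @pow2_dvd_sub_sqr_odd r u t ou ot.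
rewrite Wc Vr in E VW dVW near *.
(* From here on [X] is 2^c and [Q] is 2^r. *)
move: (2 ^ c) (2 ^ r) E VW dVW near cle Pr back => X Q E _ dVW near cle Q0 back.
have {Wc Vr} Ez : u ^ 2 + 2 * Q * t ^ 2 = X ^ 2 + t ^ 2.
  by rewrite -E -addnA -mulSnr -subSn ?muln_gt0 // subn1.
have tt0 : 0 < t ^ 2 by rewrite expn_gt0 t0.
have uX : u < X.
  rewrite -ltn_sqr -E -[ltnLHS]addn0 ltn_add2l muln_gt0 tt0 andbT subn_gt0 mul2n -addnn.
  exact: (leq_add Q0 Q0).
have XQ : X ^ 2 <= Q ^ 2 by rewrite leq_sqr.
have tQ : t ^ 2 <= Q.
  rewrite leqNgt; apply/negP => Qt.
  have : (2 * Q - 1) * Q.+1 <= Q * Q.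
    rewrite mulnn; apply: leq_trans XQ; rewrite -E.
    by apply: leq_trans (leq_addl _ _); rewrite leq_mul2l Qt orbT.
  by move: Q0; clear; nia.
(* Otherwise t^2 - u^2 would be a positive multiple of 2Q, although t^2 <= Q. *)
have tu : t <= u.
  rewrite -leq_sqr leqNgt; apply/negP => ut; have [m Em] := dvdnP dVW.
  have [Tm|mT] := leqP (t ^ 2) m.
    by have := leq_mul (leqnn (2 * Q)) Tm; move: Em ut Ez; clear; lia.
  by have := leq_mul (leqnn (2 * Q)) mT; move: Em tQ tt0 Ez; clear; lia.
have tX : t < X by apply: leq_ltn_trans uX.
have : 2 * Q %| u ^ 2 - t ^ 2.
  have -> : u ^ 2 - t ^ 2 = X ^ 2 - 2 * Q * t ^ 2 by move: Ez; clear; lia.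
  by rewrite dvdn_sub // dvdn_mulr.
case/(near tu)/orP => /dvdnP[j Ej].
  have j0 : j = 0 by case: j Ej => // j; rewrite mulSn; move: uX cle; clear; lia.
  left; have ut : u = t by rewrite j0 in Ej; move: Ej tu; clear; lia.
  by rewrite ut in Ez; move: Ez; clear; lia.
have j1 : j = 1.
  by case: j Ej => [|[|j]] //; rewrite ?mulSn; move: uX tX t0 cle; clear; lia.
have {j1 Ej} uE : u + t = Q by rewrite Ej j1 mul1n.
(* Substitute u = Q - t; since X <= Q, the term with t (t - 1) must vanish. *)
have Ek : Q ^ 2 + 2 * Q * (t * t.-1) = X ^ 2.
  by move: t0 Ez; rewrite -uE; clear; case: t => // t' _; nia.
right; have tt : t * t.-1 = 0 by move: Ek XQ Q0; clear; nia.
split; first by move: tt t0; clear; case: t => [|[]].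
by apply: back; apply/eqP; rewrite -eqn_sqr -Ek tt muln0 addn0.
Qed.

(** Descent on [c] with [r] fixed: for c > 0, u and t have the same parity; an even pair is halved,
    an odd pair is already settled. *)
Lemma sum_sqr_pow2 (r c u t : nat) : 0 < t -> c <= r ->
  u ^ 2 + (2 ^ r.+1 - 1) * t ^ 2 = 2 ^ (2 * c) ->
  2 ^ r.+1 * t ^ 2 = 2 ^ (2 * c) \/ t = 1 /\ c = r.
Proof.
have Vr : 2 ^ r.+1 = 2 * 2 ^ r by rewrite expnS.
have Pr : 0 < 2 ^ r by rewrite expn_gt0.
elim: c u t => [|c IHc] u t t0 cr E.
  have t1 : t = 1 by nia.
  have : 2 ^ r <= 2 ^ 0 by nia.
  by rewrite leq_exp2l // leqn0 => /eqP r0; right.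
have Wc : 2 ^ (2 * c.+1) = 4 * 2 ^ (2 * c) by rewrite mulnS expnD.
have odd_ut : odd u = odd t.
  have : odd (u ^ 2 + (2 ^ r.+1 - 1) * t ^ 2) = false by rewrite E Wc oddM.
  by rewrite oddD oddM !oddX oddB ?expn_gt0 // oddX /=; case: (odd u) (odd t) => [] [].
have [ot|et] := boolP (odd t).
  have ou : odd u by rewrite odd_ut.
  exact: sum_sqr_pow2_odd ou ot cr E.
have [u' Eu] : exists u', u = 2 * u' by exists (u./2); lia.
have [t' Et] : exists t', t = 2 * t' by exists (t./2); lia.
have t'0 : 0 < t' by rewrite Et muln_gt0 in t0.
have E' : u' ^ 2 + (2 ^ r.+1 - 1) * t' ^ 2 = 2 ^ (2 * c).
  apply/eqP; rewrite -(eqn_pmul2l (isT : 0 < 4)) -Wc -E Eu Et !expnMn.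
  by rewrite mulnDr (mulnCA _ (2 ^ 2)).
(* After halving, the exponent is strictly below [r], which excludes the second alternative. *)
case: (IHc u' t' t'0 (ltnW cr) E') => [E2|[_ cr']]; last by rewrite -cr' ltnn in cr.
by left; rewrite Wc -E2 Et expnMn mulnCA.
Qed.

End Arithmetic.

(** * Autocorrelation, characters of order 2 and the condition v = 4 (k - lambda) *)

Section Correlation.

Local Set Implicit Arguments.
Local Unset Strict Implicit.

Import GRing.Theory GroupScope.
Local Open Scope ring_scope.

Definition autocorrelation (gT : finGroupType) (f : gT -> int) (g : gT) : int :=
  \sum_(x : gT) f (g * x)%g * f x.

Definition charf (gT : finGroupType) (D : {set gT}) (x : gT) : int :=
  (x \in D)%:R.

Definition signf (gT : finGroupType) (D : {set gT}) (x : gT) : int :=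
  1 - 2%:R * charf D x.

Lemma sum_translate (gT : finGroupType) (f : gT -> int) (g : gT) :
  \sum_x f (g * x)%g = \sum_x f x.
Proof. by rewrite [RHS](reindex_inj (mulgI g)). Qed.

Lemma sum_charf (gT : finGroupType) (D : {set gT}) : \sum_x charf D x = #|D|%:R.
Proof.
rewrite -sum1_card natr_sum [RHS]big_mkcond. apply: eq_bigr => x _.
by rewrite /charf; case: (x \in D).
Qed.

(** A pair with quotient g has the form (g x, x), so it is determined by its second entry. *)
Lemma autocorrelation_charf (gT : finGroupType) (D : {set gT}) (g : gT) :
  autocorrelation (charf D) g
  = #|[set p in setX D D | p.1 * p.2^-1 == g]%g|%:R.
Proof.
have -> : [set p in setX D D | p.1 * p.2^-1 == g]%g
  = [set (g * x, x)%g | x in [set x | (x \in D) && (g * x \in D)%g]].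
  apply/setP => -[a b]; rewrite !inE /=; apply/idP/imsetP.
    case/andP=> /andP[aD bD] /eqP <-; exists b; last by rewrite mulgKV.
    by rewrite inE bD mulgKV aD.
  by case=> x; rewrite inE => /andP[xD gxD] [-> ->]; rewrite gxD xD mulgK eqxx.
rewrite card_imset; last by move=> x y [].
rewrite -sum1_card natr_sum big_mkcond; apply: eq_bigr => x _.
by rewrite /charf inE; case: (x \in D); case: (_ \in D).
Qed.

Lemma autocorrelation_signf (gT : finGroupType) (D : {set gT}) (g : gT) :
  autocorrelation (signf D) g
  = #|gT|%:R - 4%:R * #|D|%:R + 4%:R * autocorrelation (charf D) g.
Proof.
have -> : #|gT|%:R - 4%:R * #|D|%:R = \sum_(x : gT) (1 : int)
  - 2%:R * (\sum_x charf D (g * x)%g) - 2%:R * (\sum_x charf D x) :> int.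
  by rewrite (sum_translate (charf D)) sum_charf sumr_const; ring.
rewrite /autocorrelation !mulr_sumr -!sumrB -big_split /=.
by apply: eq_bigr => x _; rewrite /signf; ring.
Qed.

Lemma signf_product (gT1 gT2 : finGroupType) (D1 : {set gT1}) (D2 : {set gT2})
    (x : gT1 * gT2) :
  signf (diffset_product D1 D2) x = signf D1 x.1 * signf D2 x.2.
Proof. by rewrite /signf /charf !inE; do 2!case: (_ \in _). Qed.

Lemma autocorrelation_product (gT1 gT2 : finGroupType)
    (D1 : {set gT1}) (D2 : {set gT2}) (g : gT1 * gT2) :
  autocorrelation (signf (diffset_product D1 D2)) g
  = autocorrelation (signf D1) g.1 * autocorrelation (signf D2) g.2.
Proof.
rewrite /autocorrelation big_distrlr pair_bigA /=; apply: eq_bigr => x _.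
by rewrite !signf_product /=; ring.
Qed.

(** Since chi(x)^2 = 1, chi(g) = chi(g x) chi(x); as g x and x vary independently, the double sum
    factors. *)
Lemma sum_character_autocorrelation (gT : finGroupType) (f chi : gT -> int) :
  (forall x y, chi (x * y)%g = chi x * chi y) -> (forall x, chi x ^+ 2 = 1) ->
  \sum_g chi g * autocorrelation f g = (\sum_x chi x * f x) ^+ 2.
Proof.
move=> chiM chi2; rewrite expr2 [RHS]mulr_sumr.
under eq_bigr do rewrite /autocorrelation mulr_sumr.
rewrite exchange_big; apply: eq_bigr => x _.
rewrite mulr_suml [RHS](reindex_inj (mulIg x)); apply: eq_bigr => g _.
by rewrite chiM -[LHS]mul1r -(chi2 x); ring.
Qed.

(** The autocorrelation of D is k at the identity and lambda elsewhere; it is summed against chi. *)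
Lemma difference_set_character (gT : finGroupType) (v k l : nat)
    (D : {set gT}) (chi : gT -> int) :
  difference_set v k l D ->
  (forall x y, chi (x * y)%g = chi x * chi y) -> (forall x, chi x ^+ 2 = 1) ->
  (\sum_x chi x * charf D x) ^+ 2 = k%:R - l%:R + l%:R * \sum_x chi x.
Proof.
move=> [_ Dk Dl] chiM chi2.
have chi1 : chi 1%g = 1 by rewrite -(chi2 1%g) expr2 -chiM mulg1.
have N1 : autocorrelation (charf D) 1%g = k%:R.
  rewrite -Dk -sum_charf /autocorrelation; apply: eq_bigr => x _.
  by rewrite mul1g /charf; case: (_ \in _).
rewrite -sum_character_autocorrelation // [\sum_x chi x](bigD1 1%g) //=.
rewrite (bigD1 1%g) //= chi1 N1 mulrDr mulr_sumr.
under eq_bigr => g g1 do rewrite autocorrelation_charf Dl // mulrC.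
by ring.
Qed.

Lemma difference_set_count (gT : finGroupType) (v k l : nat) (D : {set gT}) :
  difference_set v k l D -> k%:R ^+ 2 = k%:R - l%:R + l%:R * v%:R :> int.
Proof.
move=> DD; have [Dv Dk _] := DD.
have := @difference_set_character _ _ _ _ _ (fun=> 1) DD.
under eq_bigr do rewrite mul1r.
by rewrite sum_charf sumr_const Dv Dk; apply=> *; rewrite ?mul1r ?expr1n.
Qed.

(** The sign character of a subgroup [H] of index 2. *)
Lemma order2_character (gT : finGroupType) (r : nat) : #|gT| = (2 ^ r.+1)%N ->
  exists chi : gT -> int, [/\ forall x y, chi (x * y)%g = chi x * chi y,
    forall x, chi x ^+ 2 = 1 & \sum_x chi x = 0].
Proof.
move=> cG; have pG : 2.-group [set: gT] by rewrite /pgroup cardsT cG pnatX.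
have [H [_ _ cH]] : exists H : {group gT},
    [/\ H \subset [set: gT], H <| [set: gT] & #|H| = (2 ^ r)%N]%g.
  by apply: normal_pgroup pG (normal_refl _) _; rewrite cardsT cG pfactorK.
have cHC : #|~: H| = #|H|.
  by apply/eqP; rewrite -(eqn_add2l #|H|) cardsC cG cH expnS mul2n addnn.
have mulH x y : ((x * y)%g \in H) = ((x \in H) == (y \in H)).
  have [xH|xH] := boolP (x \in H); first by rewrite groupMl //; case: (y \in H).
  have [yH|yH] := boolP (y \in H); first by rewrite groupMr // (negPf xH).
  (* For x and y outside [H], the coset y H is the complement of [H] and contains x^-1, which puts x
     y in [H]. *)
  have HyC : (y *: H)%g = ~: H.
    apply/eqP; rewrite eqEcard cHC card_lcoset leqnn andbT.
    apply/subsetP => z; rewrite mem_lcoset inE => yzH.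
    by apply: contra yH => zH; rewrite -groupV -(groupMr _ zH).
  have : x^-1%g \in (y *: H)%g by rewrite HyC inE groupV.
  by rewrite mem_lcoset -invMg groupV => ->.
exists (fun x => if x \in H then 1 else -1); split=> [x y|x|].
- by rewrite mulH; do 2!case: (_ \in H).
- by case: ifP.
have E x : (if x \in H then 1 else -1 : int)
    = charf H x - charf (~: H) x.
  by rewrite /charf inE; case: (x \in H).
under eq_bigr do rewrite E.
by rewrite sumrB !sum_charf cHC subrr.
Qed.

Lemma difference_set_order_square (gT : finGroupType) (r k l : nat)
    (D : {set gT}) : difference_set (2 ^ r.+1) k l D ->
  exists t : nat, k = (l + t ^ 2)%N.
Proof.
move=> DD; have [Dv _ _] := DD; have [chi [chiM chi2 chi0]] := order2_character Dv.
have := difference_set_character DD chiM chi2; rewrite chi0 mulr0 addr0.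
set a := \sum_x _ => E; exists `|a|%N; nia.
Qed.

Lemma nontrivial_difference_set_menon (gT : finGroupType) (s k l : nat)
    (D : {set gT}) : difference_set (2 ^ s) k l D -> nontrivial D ->
  (0 < s)%N -> (4 * k = 2 ^ s + 4 * l)%N.
Proof.
case: s => // r DD; have [Dv Dk _] := DD; rewrite /nontrivial Dv Dk => ntD _.
have [t kt] := difference_set_order_square DD.
have := difference_set_count DD.
have Pr : (0 < 2 ^ r)%N by rewrite expn_gt0.
have Wr : (2 ^ (2 * r) = 2 ^ r * 2 ^ r)%N by rewrite mul2n -addnn expnD.
have Vr : (2 ^ r.+1 = 2 * 2 ^ r)%N by rewrite expnS.
move: Pr Wr ntD (@sum_sqr_pow2 r r); rewrite Vr => {DD Dv}.
move: (2 ^ (2 * r))%N (2 ^ r)%N => w q q0 -> ntD solve E.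
have {}E : (k ^ 2 + l = k + l * (2 * q))%N by nia.
(* If t = 0 then k = lambda, so k = 0 or k = v, and D is trivial. *)
have [t0|t0] := posnP t.
  have lk : l = k by lia.
  have : (k * k = k * (2 * q))%N by nia.
  by move/eqP; rewrite eqn_mul2l; lia.
(* With [q] equal to v / 2, this is the counting identity after substituting k - lambda = t^2. *)
have Eu : (`|q%:Z - k%:Z| ^ 2 + (2 * q - 1) * t ^ 2 = q * q)%N by nia.
have [Et|[t1 _]] := solve _ _ t0 (leqnn r) Eu.
  have : (2 * t ^ 2 == q)%N by rewrite -(eqn_pmul2l q0) mulnA (mulnC q) Et.
  by rewrite kt => /eqP; clear; lia.
(* Here k = 1 or k = v - 1, which [nontrivial] admits only for v = 4, where k = lambda + 1 is the
   claim. *)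
have lk : k = l.+1 by rewrite kt t1; lia.
have : (l * k = l * (2 * q - 1))%N by nia.
by move/eqP; rewrite eqn_mul2l; lia.
Qed.

Lemma nontrivial_autocorrelation0 (gT : finGroupType) (s k l : nat)
    (D : {set gT}) (g : gT) : difference_set (2 ^ s) k l D -> nontrivial D ->
  g != 1%g -> autocorrelation (signf D) g = 0.
Proof.
move=> DD ntD g1; have [Dv Dk Dl] := DD.
have s0 : (0 < s)%N.
  rewrite lt0n; apply/eqP => s0; have : (1 < #|gT|)%N.
    by rewrite -cardsT; apply/card_gt1P; exists g, 1%g; rewrite !inE.
  by rewrite Dv s0.
have := nontrivial_difference_set_menon DD ntD s0.
rewrite autocorrelation_signf autocorrelation_charf Dl // Dv Dk; lia.
Qed.

Lemma difference_set_product (gT1 gT2 : finGroupType)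
    (v1 v2 k1 l1 k2 l2 v : nat) (D1 : {set gT1}) (D2 : {set gT2}) :
  difference_set (2 ^ v1) k1 l1 D1 -> difference_set (2 ^ v2) k2 l2 D2 ->
  nontrivial D1 -> nontrivial D2 -> #|{: gT1 * gT2}| = v ->
  exists k l : nat, difference_set v k l (diffset_product D1 D2).
Proof.
move=> DD1 DD2 nt1 nt2 cG; set D := diffset_product D1 D2.
(* If N pairs have quotient g, vanishing autocorrelation means v - 4 |D| + 4 N = 0; this fixes N and
   makes the division by 4 exact. *)
exists #|D|, (#|D| - v %/ 4)%N; split=> // g g1.
have := autocorrelation_product D1 D2 g.
have -> : autocorrelation (signf D1) g.1 * autocorrelation (signf D2) g.2 = 0.
  case: g g1 => a b; rewrite xpair_eqE negb_and /= => /orP[a1|b1].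
    by rewrite (nontrivial_autocorrelation0 DD1) // mul0r.
  by rewrite (nontrivial_autocorrelation0 DD2) // mulr0.
rewrite -/D autocorrelation_signf autocorrelation_charf cG.
by move: #|D| #|[set p in _ | _]| => m N; lia.
Qed.

End Correlation.

(** * Blocks of the product and their symmetric differences *)

Section SymmetricDifference.

Local Set Implicit Arguments.
Local Unset Strict Implicit.

Import GroupScope.

Lemma in_symdiff (T : finType) (A B : {set T}) (x : T) :
  (x \in symdiff A B) = (x \in A) (+) (x \in B).
Proof. by rewrite !inE; do 2!case: (x \in _). Qed.

Lemma in_diffset_product (gT1 gT2 : finGroupType)
    (D1 : {set gT1}) (D2 : {set gT2}) (x : gT1 * gT2) :
  (x \in diffset_product D1 D2) = (x.1 \in D1) (+) (x.2 \in D2).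
Proof. by rewrite !inE; do 2!case: (_ \in _). Qed.

Lemma lcoset_diffset_product (gT1 gT2 : finGroupType)
    (D1 : {set gT1}) (D2 : {set gT2}) (g : gT1 * gT2) :
  g *: diffset_product D1 D2 = diffset_product (g.1 *: D1) (g.2 *: D2).
Proof.
by apply/setP => x; rewrite mem_lcoset !in_diffset_product !mem_lcoset.
Qed.

(** Translation acts coordinatewise, and the two translating elements can be chosen
    independently. *)
Lemma development_product (gT1 gT2 : finGroupType)
    (D1 : {set gT1}) (D2 : {set gT2}) (B : {set gT1 * gT2}) :
  reflect (exists B1 B2, [/\ B1 \in development D1, B2 \in development D2 &
             B = diffset_product B1 B2])
          (B \in development (diffset_product D1 D2)).
Proof.
apply: (iffP imsetP) => [[g _ ->]|[_ [_ [/imsetP[a _ ->] /imsetP[b _ ->] ->]]]].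
  exists (g.1 *: D1), (g.2 *: D2).
  by split; [exact: imset_f | exact: imset_f | exact: lcoset_diffset_product].
by exists (a, b) => //; rewrite lcoset_diffset_product.
Qed.

Lemma symdiff_diffset_product (gT1 gT2 : finGroupType)
    (A1 B1 : {set gT1}) (A2 B2 : {set gT2}) :
  symdiff (diffset_product A1 A2) (diffset_product B1 B2)
  = diffset_product (symdiff A1 B1) (symdiff A2 B2).
Proof.
apply/setP => x; rewrite in_symdiff !in_diffset_product !in_symdiff.
by do 4!case: (_ \in _).
Qed.

Lemma diffset_productCl (gT1 gT2 : finGroupType)
    (D1 : {set gT1}) (D2 : {set gT2}) :
  diffset_product (~: D1) D2 = ~: diffset_product D1 D2.
Proof.
by apply/setP => x; rewrite in_setC !in_diffset_product in_setC addNb.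
Qed.

Lemma diffset_productCr (gT1 gT2 : finGroupType)
    (D1 : {set gT1}) (D2 : {set gT2}) :
  diffset_product D1 (~: D2) = ~: diffset_product D1 D2.
Proof.
by apply/setP => x; rewrite in_setC !in_diffset_product in_setC addbN.
Qed.

Lemma diffset_productC (gT1 gT2 : finGroupType)
    (D1 : {set gT1}) (D2 : {set gT2}) (x : gT1) (y : gT2) :
  ((x, y) \in diffset_product D1 D2) = ((y, x) \in diffset_product D2 D1).
Proof. by rewrite !in_diffset_product addbC. Qed.

(* Restrict to the fibre over a point of the second factor. *)
Lemma diffset_product_eql (gT1 gT2 : finGroupType)
    (A B : {set gT1}) (A' B' : {set gT2}) :
  diffset_product A A' = diffset_product B B' -> A = B \/ ~: A = B.
Proof.
move=> /setP E; have {}E x : (x \in A) (+) (1 \in A') = (x \in B) (+) (1 \in B').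
  by have := E (x, 1); rewrite !in_diffset_product.
case e: ((1 \in A') == (1 \in B')); [left|right]; apply/setP => x;
  rewrite ?in_setC; move: (E x) e;
  by case: (x \in A) (x \in B) (1 \in A') (1 \in B') => [] [] [] [].
Qed.

Lemma diffset_product_eqr (gT1 gT2 : finGroupType)
    (A B : {set gT1}) (A' B' : {set gT2}) :
  diffset_product A A' = diffset_product B B' -> A' = B' \/ ~: A' = B'.
Proof.
move=> /setP E; apply: (@diffset_product_eql _ _ _ _ A B).
by apply/setP => -[y x]; rewrite diffset_productC E diffset_productC.
Qed.

Lemma SDP_product (gT1 gT2 : finGroupType) (D1 : {set gT1}) (D2 : {set gT2}) :
  has_SDP (diffset_product D1 D2) <-> has_SDP D1 /\ has_SDP D2.
Proof.
have self (gT : finGroupType) (D : {set gT}) : D \in development D.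
  by apply/imsetP; exists 1 => //; apply/setP => x; rewrite mem_lcoset invg1 mul1g.
have symdiffK (T : finType) (A : {set T}) : symdiff (symdiff A A) A = A.
  by apply/setP => x; rewrite !in_symdiff addbb.
split=> [sD | [s1 s2] _ _ _ /development_product[A1 [A2 [a1 a2 ->]]]
                    /development_product[B1 [B2 [b1 b2 ->]]]
                    /development_product[C1 [C2 [c1 c2 ->]]]].
  split=> A B C dA dB dC.
    (* Each block is paired with the same [D2]; three copies of [D2] sum to [D2], and comparing
       first factors recovers the sum of the three blocks up to complement. *)
    have dev E : E \in development D1 ->
        diffset_product E D2 \in development (diffset_product D1 D2).
      by move=> dE; apply/development_product; exists E, D2; split=> //; exact: self.
    case: (sD _ _ _ (dev _ dA) (dev _ dB) (dev _ dC));
      rewrite !symdiff_diffset_product symdiffK -?diffset_productCl;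
      case/development_product=> E1 [E2 [e1 _ /diffset_product_eql[]]] E;
      move: e1; rewrite -E ?setCK => e1; by [left | right].
  have dev E : E \in development D2 ->
      diffset_product D1 E \in development (diffset_product D1 D2).
    by move=> dE; apply/development_product; exists D1, E; split=> //; exact: self.
  case: (sD _ _ _ (dev _ dA) (dev _ dB) (dev _ dC));
    rewrite !symdiff_diffset_product symdiffK -?diffset_productCr;
    case/development_product=> E1 [E2 [_ e2 /diffset_product_eqr[]]] E;
    move: e2; rewrite -E ?setCK => e2; by [left | right].
rewrite !symdiff_diffset_product.
(* A complement in one coordinate complements the product, and complements in both cancel. *)
case: (s1 _ _ _ a1 b1 c1) (s2 _ _ _ a2 b2 c2) => [S1|S1] [S2|S2].
- by left; apply/development_product; do 2 eexists; split; [exact: S1 | exact: S2 |].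
- right; apply/development_product; do 2 eexists; split; [exact: S1 | exact: S2 |].
  by rewrite diffset_productCr.
- right; apply/development_product; do 2 eexists; split; [exact: S1 | exact: S2 |].
  by rewrite diffset_productCl.
left; apply/development_product; do 2 eexists; split; [exact: S1 | exact: S2 |].
by rewrite diffset_productCl diffset_productCr setCK.
Qed.

End SymmetricDifference.

Theorem theorem3p1 (gT1 gT2 : finGroupType) (n v1 v2 k1 l1 k2 l2 : nat)
    (D1 : {set gT1}) (D2 : {set gT2})
    (hG : #|{: gT1 * gT2}| = 2 ^ (2 * n))
    (hG1 : #|gT1| = 2 ^ v1) (hG2 : #|gT2| = 2 ^ v2)
    (hv1 : ~~ odd v1) (hv2 : ~~ odd v2)
    (hD1 : difference_set (2 ^ v1) k1 l1 D1)
    (hD2 : difference_set (2 ^ v2) k2 l2 D2) :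
  (nontrivial D1 -> nontrivial D2 ->
     exists k l : nat,
       difference_set (2 ^ (2 * n)) k l (diffset_product D1 D2)) /\
  (has_SDP (diffset_product D1 D2) <-> has_SDP D1 /\ has_SDP D2).
Proof.
split; last exact: SDP_product.
by move=> nt1 nt2; apply: difference_set_product hD1 hD2 nt1 nt2 hG.
Qed.
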